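(* Let $d\ge 1$ and let $W:\mathbb{R}^d\to\mathbb{R}\cup\{+\infty\}$ be a measurable function satisfying all of the following: (1) $W$ is bounded from below by a finite constant $W_{\min}<0$; (2) $W$ is locally integrable, i.e. $\int_B |W|<+\infty$ for every open ball $B\subset\mathbb{R}^d$; (3) $W(x)=W(-x)$ for all $x\in\mathbb{R}^d$; (4) $W$ is lower semi-continuous; (5) the limit $W_\infty:=\lim_{|x|\to\infty}W(x)$ exists (possibly equal to $+\infty$). Suppose moreover that there exists a $d_2$-local minimiser $\rho\in\mathcal{P}(\mathbb{R}^d)$ of the energy $E$ with $E(\rho)<\frac12 W_\infty$. Then $\rho$ is compactly supported.
   Context: $\mathcal{P}(\mathbb{R}^d)$ denotes the set of (Borel) probability measures on $\mathbb{R}^d$. The interaction energy $E:\mathcal{P}(\mathbb{R}^d)\to\mathbb{R}\cup\{+\infty\}$ is $$E(\rho)=\frac12\int_{\mathbb{R}^d\times\mathbb{R}^d}W(x-y)\,d\rho(x)\,d\rho(y),$$ which is well defined because $W$ is bounded from below. The quadratic Wasserstein distance is $d_2(\mu,\nu)=\left(\inf_{\pi}\int_{\mathbb{R}^d\times\mathbb{R}^d}|x-y|^2\,d\pi(x,y)\right)^{1/2}\in[0,+\infty]$, the infimum being over all couplings $\pi$ of $\mu,\nu\in\mathcal{P}(\mathbb{R}^d)$. A measure $\rho\in\mathcal{P}(\mathbb{R}^d)$ is a $d_2$-local minimiser of $E$ if there is $\varepsilon>0$ such that $E(\rho)\le E(\mu)$ for all $\mu\in\mathcal{P}(\mathbb{R}^d)$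 with $d_2(\mu,\rho)<\varepsilon$. *)

(* Defs.v *)
From HB Require Import structures.
From mathcomp Require Import all_boot all_order all_algebra.
From mathcomp Require Import all_classical all_reals all_analysis.
From mathcomp Require Import measurable_realfun.

Set Implicit Arguments.
Unset Strict Implicit.
Unset Printing Implicit Defensive.

Import Order.TTheory GRing.Theory Num.Theory.
Import numFieldNormedType.Exports.

Local Open Scope classical_set_scope.
Local Open Scope ring_scope.
Local Open Scope ereal_scope.

HB.instance Definition _ (R : realType) (n : nat) :=
  @isMeasurable.Build (sigma_display (@open 'rV[R]_n)) 'rV[R]_n
    <<s @open 'rV[R]_n >> (@sigma_algebra0 _ setT _) (@sigma_algebraC _ _)
    (@sigma_algebra_bigcup _ setT _).

Lemma measure_sigma_finiteW d (T : measurableType d)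
    (R : realType) (p : {measure set T -> \bar R}) :
  sigma_finite setT p ->
  exists m : {sigma_finite_measure set T -> \bar R}, p = m :> (set T -> \bar R).
Proof.
case: p => p c sf.
pose p' : {measure set T -> \bar R} := Measure.Pack c.
pose s := Measure_isSigmaFinite.Build _ _ _ p' sf.
by exists (HB.pack_for {sigma_finite_measure set T -> \bar R} p p' s).
Qed.

Section lebesgue_rV.
Context {R : realType}.

Definition rV_cons (n : nat) (p : measurableTypeR R * 'rV[R]_n) : 'rV[R]_n.+1 :=
  \row_j (if unlift ord0 j is Some i then p.2 ord0 i else p.1).

(* Lebesgue measure on R^n: the n-fold product of the Lebesgue measure on R. *)
Fixpoint lebesgue_rV (n : nat) : set 'rV[R]_n -> \bar R :=
  match n with
  | 0 => @dirac _ 'rV[R]_0 0%R R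
  | m.+1 => pushforward (lebesgue_measure \x @lebesgue_rV m) (@rV_cons m)
  end.

Lemma open_rV_bigcup (n : nat) (U : set 'rV[R]_n) : open U ->
  exists F : 'rV[rat]_n * rat -> bool,
  U = \bigcup_(q in [set q | F q]) ball (map_mx ratr q.1 : 'rV[R]_n) (ratr q.2).
Proof.
move=> oU.
exists (fun q => `[< ball (map_mx ratr q.1 : 'rV[R]_n) (ratr q.2) `<=` U >]).
apply/seteqP; split=> [x Ux|x [q /asboolP]]; last exact.
have /nbhs_ballP[e /= e0 eU] : nbhs x U by exact: open_nbhs_nbhs.
have e20 : (0 < e / 2 :> R)%R by rewrite divr_gt0.
have [r] := rat_in_itvoo e20; rewrite in_itv/= => /andP[r0 re].
have h i : exists q : rat, ball (ratr q : R) (ratr r) (x ord0 i).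
  have : (x ord0 i - ratr r < x ord0 i :> R)%R by rewrite ltrBlDr ltrDl.
  move=> /rat_in_itvoo[q]; rewrite in_itv/= => /andP[qx xq].
  exists q; rewrite /ball/= ler0_norm ?subr_le0 ?ltW// opprB.
  by rewrite ltrBlDl -ltrBlDr.
have [q qP] := choice h.
pose Q : 'rV[rat]_n := \row_i q i.
have Qx : ball (map_mx ratr Q : 'rV[R]_n) (ratr r) x.
  by split=> // i j; rewrite !mxE ord1; exact: qP.
exists (Q, r) => //=; apply/asboolP => y Qy; apply: eU.
apply: (@le_ball _ _ _ (ratr r + ratr r)%R).
  by rewrite (splitr e) lerD// ltW.
by apply: ball_triangle Qy; exact: ball_sym.
Qed.

Lemma measurable_rV_cons (n : nat) : measurable_fun setT (@rV_cons n).
Proof.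
apply: (@measurability _ _ _ _ _ _ (@open 'rV[R]_n.+1)) => // _ [U oU <-].
rewrite setTI; have [F ->] := open_rV_bigcup oU.
rewrite preimage_bigcup bigcup_mkcond.
apply: countable_bigcupT_measurable => // -[q r]; case: ifP => // _.
have [r0|r0] := ltP 0%R (ratr r : R); last first.
  rewrite [X in measurable X](_ : _ = set0)//.
  by apply/seteqP; split=> // p [] /=; rewrite ltNge r0.
rewrite [X in measurable X](_ : _ = ball (ratr (q ord0 ord0) : R) (ratr r) `*`
  ball (\row_i ratr (q ord0 (lift ord0 i)) : 'rV[R]_n) (ratr r)).
  apply: measurableX; first exact: measurable_ball.
  by apply: sub_sigma_algebra; exact: ball_open.
apply/seteqP; split=> [[a v] [_ /= H]|[a v] [/= Ha [_ Hv]]].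
  split=> /=; first by have := H ord0 ord0; rewrite !mxE unlift_none.
  split=> // i j; have := H ord0 (lift ord0 j).
  by rewrite !mxE liftK !ord1.
split=> // i j; rewrite !mxE ord1; case: unliftP => [k|] ->//.
by have := Hv ord0 k; rewrite !mxE.
Qed.

Lemma measurable_rV_coord (n : nat) (i : 'I_n) :
  measurable_fun [set: 'rV[R]_n] (fun v => v ord0 i : measurableTypeR R).
Proof.
apply: (@measurability _ _ _ _ _ _ (@RGenOpens.G R)).
  exact: RGenOpens.measurableE.
move=> _ [_ [a [b ->]] <-].
rewrite setTI; apply: sub_sigma_algebra; apply: open_comp => [v _|].
  exact: coord_continuous.
exact: interval_open.
Qed.

Lemma lebesgue_rV_sigma_finite_measure (n : nat) :
  exists m : {sigma_finite_measure set 'rV[R]_n -> \bar R},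
    @lebesgue_rV n = m.
Proof.
elim: n => [|n [m IHn]]; first by exists (@dirac _ 'rV[R]_0 0%R R).
rewrite /= IHn.
pose mu : {measure set (measurableTypeR R * 'rV[R]_n)%type -> \bar R} :=
  @lebesgue_measure R \x m.
have sfmu : sigma_finite setT mu.
  have /sigma_finiteP[F [TF ndF Foo]] := sigma_finiteT (@lebesgue_measure R).
  have /sigma_finiteP[G [TG ndG Goo]] := sigma_finiteT m.
  exists (fun k => F k `*` G k).
    rewrite -setXTT TF TG; apply/seteqP; split=> -[x y] /=.
      move=> [[i _ Fix] [k _ Gky]]; exists (maxn i k) => //; split.
        by move: x Fix; exact/subsetPset/ndF/leq_maxl.
      by move: y Gky; exact/subsetPset/ndG/leq_maxr.
    by move=> [k _ [? ?]]; split; exists k.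
  move=> k; have [? ?] := Foo k; have [? ?] := Goo k.
  split; first exact: measurableX.
  by rewrite /mu/= product_measure1E// lte_mul_pinfty// ge0_fin_numE.
have mc := @measurable_rV_cons n.
have sf : sigma_finite setT (pushforward mu (@rV_cons n)).
  have [G TG Goo] := sfmu.
  pose g (v : 'rV[R]_n.+1) : measurableTypeR R * 'rV[R]_n :=
    (v ord0 ord0, \row_i v ord0 (lift ord0 i)).
  have mg : measurable_fun setT g.
    apply/measurable_fun_pairP; split.
      exact: measurable_rV_coord.
    apply: (@measurability _ _ _ _ _ _ (@open 'rV[R]_n)) => // _ [U oU <-].
    rewrite setTI; apply: sub_sigma_algebra; apply: open_comp oU => v _.
    move=> A /= /nbhs_ballP[e /= e0 eA].
    apply/nbhs_ballP; exists e => //= w [_ vw]; apply: eA; split => // i j.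
    by rewrite !mxE; exact: vw.
  exists (fun k => g @^-1` G k).
    by rewrite -preimage_bigcup -TG preimage_setT.
  move=> k; have [mG Gk] := Goo k; split.
    by rewrite -[X in measurable X]setTI; exact: mg.
  rewrite /pushforward -comp_preimage (_ : g \o _ = id)//.
  apply/funext => -[a v]; rewrite /g /= mxE unlift_none; congr pair.
  by apply/rowP => i; rewrite !mxE liftK.
have [p pE] : exists p : {measure set 'rV[R]_n.+1 -> \bar R},
    pushforward mu (@rV_cons n) = p.
  by unshelve (eexists; reflexivity).
rewrite -/mu pE in sf *.
exact: measure_sigma_finiteW.
Qed.

Let lebesgue_rV0 n : @lebesgue_rV n set0 = 0.
Proof. by have [m ->] := lebesgue_rV_sigma_finite_measure n. Qed.

Let lebesgue_rV_ge0 n A : 0 <= @lebesgue_rV n A.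
Proof. by have [m ->] := lebesgue_rV_sigma_finite_measure n. Qed.

Let lebesgue_rV_sigma_additive n : semi_sigma_additive (@lebesgue_rV n).
Proof.
have [m ->] := lebesgue_rV_sigma_finite_measure n.
exact: measure_semi_sigma_additive.
Qed.

HB.instance Definition _ n := isMeasure.Build _ _ _ (@lebesgue_rV n)
  (@lebesgue_rV0 n) (@lebesgue_rV_ge0 n) (@lebesgue_rV_sigma_additive n).

Let lebesgue_rV_sigma_finite n : sigma_finite setT (@lebesgue_rV n).
Proof.
by have [m ->] := lebesgue_rV_sigma_finite_measure n; exact: sigma_finiteT.
Qed.

HB.instance Definition _ n := Measure_isSigmaFinite.Build _ _ _ (@lebesgue_rV n)
  (@lebesgue_rV_sigma_finite n).

Lemma lebesgue_rV_box (n : nat) (a b : 'rV[R]_n) :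
  (forall i, a ord0 i <= b ord0 i)%R ->
  lebesgue_rV [set v : 'rV[R]_n | forall i, v ord0 i \in `]a ord0 i, b ord0 i]] =
    (\prod_i (b ord0 i - a ord0 i))%:E.
Proof.
elim: n a b => [|n IHn] a b ab.
  rewrite big_ord0 /= diracE mem_set//= => i; by case: i.
pose a' : 'rV[R]_n := \row_i a ord0 (lift ord0 i).
pose b' : 'rV[R]_n := \row_i b ord0 (lift ord0 i).
rewrite big_ord_recl.
rewrite [LHS](_ : _ = (lebesgue_measure \x @lebesgue_rV n)
    (`]a ord0 ord0, b ord0 ord0]%classic `*`
     [set v : 'rV[R]_n | forall i, v ord0 i \in `]a' ord0 i, b' ord0 i]])).
  have mB : measurable [set v : 'rV[R]_n |
      forall i, v ord0 i \in `]a' ord0 i, b' ord0 i]].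
    rewrite (_ : [set _ | _] =
      \bigcap_i [set v : 'rV[R]_n | v ord0 i \in `]a' ord0 i, b' ord0 i]]).
      apply: fin_bigcap_measurable => // i _; rewrite -[X in measurable X]setTI.
      exact: (measurable_rV_coord i measurableT (measurable_itv _)).
    by apply/seteqP; split=> v /= h i; [move=> _|]; exact: h.
  have := @product_measure1E _ _ _ _ R (@lebesgue_measure R) (@lebesgue_rV n).
  move=> -> //.
  rewrite /= lebesgue_measure_itv/= lte_fin IHn; last first.
    by move=> i; rewrite !mxE.
  rewrite (eq_bigr (fun i => b ord0 (lift ord0 i) - a ord0 (lift ord0 i))%R); last first.
    by move=> i _; rewrite !mxE.
  case: ifPn => [_|]; first by rewrite -EFinB -EFinM.
  rewrite -leNgt => ba.
  have -> : a ord0 ord0 = b ord0 ord0 by apply/eqP; rewrite eq_le ba ab.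
  by rewrite subrr !mul0r mul0e.
congr (product_measure1 _ _ _).
apply/seteqP; split=> [[x v] /= h|[x v] /= [hx hv] i].
  split; first by have := h ord0; rewrite mxE unlift_none.
  by move=> i; have := h (lift ord0 i); rewrite !mxE liftK.
rewrite mxE; case: unliftP => [j|] -> //.
by have := hv j; rewrite !mxE.
Qed.

End lebesgue_rV.
Arguments lebesgue_rV {R n} _.

Section euclidean.
Context {R : realType} {d : nat}.
Implicit Types x y : 'rV[R]_d.

(* The library's norm on matrices is the sup norm. *)
Definition enorm x : R := Num.sqrt (\sum_i x ord0 i ^+ 2)%R.

Definition eball x (r : R) : set 'rV[R]_d := [set y | (enorm (y - x) < r)%R].

(* The neighbourhoods of infinity: F @ infty_rV is the limit as |x| --> +oo. *)
Definition infty_rV : set_system 'rV[R]_d :=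
  filter_from [set: R] (fun M => [set x | (M < enorm x)%R]).

Global Instance infty_rV_filter : Filter infty_rV.
Proof.
apply: filter_from_filter; first by exists 0%R.
move=> M N _ _; exists (Num.max M N) => // x /=.
by rewrite gt_max => /andP[].
Qed.

End euclidean.

Section interaction_energy.
Context {R : realType} {d : nat}.
Implicit Types (W : 'rV[R]_d -> \bar R) (mu nu rho : probability 'rV[R]_d R).

Definition energy W rho : \bar R :=
  (2^-1)%:E * \int[rho \x rho]_z W (z.1 - z.2)%R.

Definition coupling mu nu : set (probability ('rV[R]_d * 'rV[R]_d)%type R) :=
  [set gamma | forall A, measurable A ->
    pushforward gamma fst A = mu A /\ pushforward gamma snd A = nu A].

Definition wasserstein2 mu nu : \bar R :=
  ereal_inf [set \int[gamma]_z (enorm (z.1 - z.2) ^+ 2)%:E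
            | gamma in coupling mu nu] `^ 2^-1.

Definition d2_local_minimiser W rho : Prop :=
  exists2 eps : R, (0 < eps)%R &
    forall mu, wasserstein2 mu rho < eps%:E -> energy W rho <= energy W mu.

Definition msupport rho : set 'rV[R]_d :=
  [set x | forall U, open U -> U x -> 0 < rho U].

Definition compactly_supported rho : Prop := compact (msupport rho).

End interaction_energy.

(* Main.v *)
Require Import Defs.
From HB Require Import structures.
From mathcomp Require Import all_boot all_order all_algebra.
From mathcomp Require Import all_classical all_reals all_analysis.
From mathcomp Require Import measurable_realfun.
From mathcomp Require Import ring lra.

(** The potential [psi x = \int W (x - y) d rho(y)] of a local minimiser cannot
have a larger average on one charged bounded set than on another: moving a small
amount of mass from the first to the second would lower the energy. Since the
average of [psi] with respect to [rho] is [2 E(rho)], this says that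
[psi = 2 E(rho)] almost everywhere. But [psi] is asymptotically at least
[W_infty > 2 E(rho)] at infinity, because [rho] is concentrated, up to a small
mass, on a ball. So far regions carry no mass, and the support is bounded.

In more detail, [W] is first replaced by the nonnegative kernel [W - Wmin],
which changes all energies of probability measures by the same constant
([energy_shift]). Let [i] be the average of the new potential. By
[potential_far] there are a level [high > i] and a ball outside of which the
potential is at least [high]. Suppose that the complement of the ball is
charged, and let [A] be a bounded charged piece of it. For a level [low]
strictly between [i] and [high] the set where the potential is at most [low] is
charged ([measure_sublevel_gt0]); let [B] be a bounded charged piece of it.

Let [mu] be obtained from [rho] by moving a fraction [s] of the mass of [A] onto
[B] ([transport_plan]). As [A] and [B] are bounded, the quadratic cost is of
order [s], whatever the moments of [rho]. The energy of [mu] is a polynomial in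
[s] ([energy_perturbation]) whose linear coefficient is at most a negative
multiple of [high - low]. For small [s] the measure [mu] is thus close to [rho]
with less energy ([lower_energy]), against local minimality. *)

Set Implicit Arguments.
Unset Strict Implicit.
Unset Printing Implicit Defensive.

Import Order.TTheory GRing.Theory Num.Theory.
Import numFieldNormedType.Exports.

Local Open Scope classical_set_scope.
Local Open Scope ring_scope.
Local Open Scope ereal_scope.

(** * Squared norms and measurability *)

Section measurability.
Context d (T : measurableType d) (R : realType) (n : nat).

(** Open sets are countable unions of boxes with rational data, and the
preimage of a box is a finite intersection of preimages under coordinates. *)
Lemma measurable_fun_rV (f : T -> 'rV[R]_n) :
  (forall i, measurable_fun setT (fun x => f x ord0 i : measurableTypeR R)) ->
  measurable_fun setT f.
Proof.
move=> mf; apply: (@measurability _ _ _ _ _ _ (@open 'rV[R]_n)) => // _ [U oU <-].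
rewrite setTI; have [F ->] := open_rV_bigcup oU.
rewrite preimage_bigcup bigcup_mkcond.
apply: countable_bigcupT_measurable => // -[q r]; case: ifP => // _.
have [r0|r0] := ltP 0%R (ratr r : R); last first.
  rewrite [X in measurable X](_ : _ = set0)//.
  by apply/seteqP; split=> // p [] /=; rewrite ltNge r0.
rewrite [X in measurable X](_ : _ = \bigcap_i
  ((fun x => f x ord0 i : measurableTypeR R) @^-1`
     ball (ratr (q ord0 i) : R) (ratr r))).
  apply: fin_bigcap_measurable => // i _; rewrite -[X in measurable X]setTI.
  by apply: mf => //; exact: measurable_ball.
apply/seteqP; split=> [x [_ H] i _|x H] /=.
  by have := H ord0 i; rewrite !mxE.
by split=> // i j; have := H j Logic.I; rewrite !mxE !ord1.
Qed.

End measurability.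

Section sqnorm.
Context {R : realType} {d : nat}.
Implicit Types x y : 'rV[R]_d.

(** The squared Euclidean norm is used in place of the norm: the two
inequalities below, with the factor 2, replace the triangle inequality and
need no square roots. *)
Definition sqnorm x : R := (\sum_i x ord0 i ^+ 2)%R.

Lemma sqnorm_ge0 x : (0 <= sqnorm x)%R.
Proof. by apply: sumr_ge0 => i _; exact: sqr_ge0. Qed.

Lemma enorm_sqr x : (enorm x ^+ 2 = sqnorm x)%R.
Proof. by rewrite sqr_sqrtr// sqnorm_ge0. Qed.

Lemma sqnormB_le x y : (sqnorm (x - y) <= 2 * sqnorm x + 2 * sqnorm y)%R.
Proof.
rewrite /sqnorm !mulr_sumr -big_split/=; apply: ler_sum => i _; rewrite !mxE.
(* 2 a^2 + 2 b^2 - (a - b)^2 = (a + b)^2 *)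
have := sqr_ge0 (x ord0 i + y ord0 i)%R; rewrite -subr_ge0; nra.
Qed.

Lemma sqnorm_leB x y : (sqnorm x <= 2 * sqnorm (x - y) + 2 * sqnorm y)%R.
Proof.
rewrite /sqnorm !mulr_sumr -big_split/=; apply: ler_sum => i _; rewrite !mxE.
(* 2 (a - b)^2 + 2 b^2 - a^2 = (a - 2 b)^2 *)
have := sqr_ge0 (x ord0 i - y ord0 i - y ord0 i)%R; rewrite -subr_ge0; nra.
Qed.

Lemma measurable_sqnorm :
  measurable_fun setT (sqnorm : 'rV[R]_d -> measurableTypeR R).
Proof.
apply: measurable_sum => i; apply: measurable_funX.
exact: measurable_rV_coord.
Qed.

Lemma measurable_subr :
  measurable_fun setT (fun z : 'rV[R]_d * 'rV[R]_d => (z.1 - z.2)%R).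
Proof.
apply: measurable_fun_rV => i.
under eq_fun do rewrite !mxE.
apply: measurable_funB.
  exact: (measurableT_comp (measurable_rV_coord i) measurable_fst).
exact: (measurableT_comp (measurable_rV_coord i) measurable_snd).
Qed.

Lemma sqnorm_bounded_compact (S : set 'rV[R]_d) (r : R) :
  closed S -> (forall x i, S x -> (x ord0 i ^+ 2 <= r)%R) -> compact S.
Proof.
move=> clS Sr; pose I := `[(- (1 + `|r|))%R, (1 + `|r|)%R].
have cI : compact [set v : 'rV[R]_d | forall i, v ord0 i \in I].
  by apply: (@rV_compact _ _ (fun=> [set` I])) => _; exact: segment_compact.
apply: subclosed_compact clS cI _ => x Sx i /=.
rewrite in_itv/= -ler_norml -(@ler_pXn2r _ 2) ?nnegrE ?addr_ge0//.
rewrite real_normK ?num_real//; apply: le_trans (Sr x i Sx) _.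
have := ler_norm r; have := normr_ge0 r; nra.
Qed.

End sqnorm.

(** * Transport of a fraction of mass between two sets *)

Section restricted_measure.
Context d (T : measurableType d) (R : realType).
Implicit Types (m : {measure set T -> \bar R}) (D : set T) (f : T -> \bar R).

(** The complement of [D] is null for the restricted measure, which agrees with
[m] on the subsets of [D]. *)
Lemma ge0_integral_mrestr m D (mD : measurable D) f :
  measurable_fun setT f -> (forall x, 0 <= f x) ->
  \int[mrestr m mD]_x f x = \int[m]_(x in D) f x.
Proof.
move=> mf f0.
rewrite (@ge0_negligible_integral _ _ _ _ setT (~` D))//; last 2 first.
- exact: measurableC.
- by change (m (~` D `&` D) = 0); rewrite setICl measure0.
rewrite setTD setCK; apply: eq_measure_integral => A mA AD.
by rewrite -[in RHS](setIidl AD).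
Qed.

Lemma ge0_integral_setC m D f : measurable D ->
  measurable_fun setT f -> (forall x, 0 <= f x) ->
  \int[m]_x f x = \int[m]_(x in D) f x + \int[m]_(x in ~` D) f x.
Proof.
move=> mD mf f0; rewrite -ge0_integral_setU ?setUv//.
  exact: measurableC.
by rewrite disj_set2E setICr.
Qed.

End restricted_measure.

Section product_restricted.
Context d1 d2 (T1 : measurableType d1) (T2 : measurableType d2) (R : realType).
Variables (m1 : {sigma_finite_measure set T1 -> \bar R})
          (m2 : {sigma_finite_measure set T2 -> \bar R}).
Variables (A : set T1) (B : set T2) (f : T1 * T2 -> \bar R).
Hypotheses (mA : measurable A) (mB : measurable B).
Hypotheses (mf : measurable_fun setT f) (f0 : forall z, 0 <= f z).

Let fAB := f \_ (A `*` B).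

Let mfAB : measurable_fun setT fAB.
Proof.
apply/measurable_restrict => //; first exact: measurableX.
exact: measurable_funTS.
Qed.

Let fAB0 z : 0 <= fAB z.
Proof. exact: erestrict_ge0. Qed.

Lemma fubini_tonelli1_setX :
  \int[m1 \x m2]_(z in A `*` B) f z = \int[m1]_(x in A) \int[m2]_(y in B) f (x, y).
Proof.
rewrite integral_mkcond fubini_tonelli1// [RHS]integral_mkcond.
apply: eq_integral => x _; rewrite /fubini_F !patchE.
case: ifPn => xA.
  rewrite [RHS]integral_mkcond; apply: eq_integral => y _.
  by rewrite !patchE in_setX xA.
by apply: integral0_eq => y _; rewrite /fAB patchE in_setX (negbTE xA).
Qed.

Lemma fubini_tonelli2_setX :
  \int[m1 \x m2]_(z in A `*` B) f z = \int[m2]_(y in B) \int[m1]_(x in A) f (x, y).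
Proof.
rewrite integral_mkcond fubini_tonelli2// [RHS]integral_mkcond.
apply: eq_integral => y _; rewrite /fubini_G !patchE.
case: ifPn => yB.
  rewrite [RHS]integral_mkcond; apply: eq_integral => x _.
  by rewrite !patchE in_setX yB andbT.
by apply: integral0_eq => x _; rewrite /fAB patchE in_setX (negbTE yB) andbF.
Qed.

End product_restricted.

Section transport.
Context d (T : measurableType d) (R : realType) (P : probability T R).
Variables (A B : set T) (mA : measurable A) (mB : measurable B) (s c : R).
Hypotheses (s_ge0 : (0 <= s)%R) (s_le1 : (s <= 1)%R) (c_ge0 : (0 <= c)%R).
Hypothesis cB : c%:E * P B = s%:E.

Let s1_ge0 : (0 <= 1 - s)%R. Proof. by rewrite subr_ge0. Qed.

Let diag (x : T) := (x, x).

Let mdiag : measurable_fun setT diag.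
Proof. by apply: measurable_fun_pair; exact: measurable_id. Qed.

(* The mass that stays in place: everything outside A, a fraction 1 - s of A. *)
Let kept : {measure set T -> \bar R} :=
  measure_add (mrestr P (measurableC mA)) (mscale (NngNum s1_ge0) (mrestr P mA)).

(* The mass s P(A) taken from A, spread over B in proportion to P. *)
Let moved : {measure set (T * T)%type -> \bar R} :=
  mscale (NngNum c_ge0) (mrestr (P \x P) (measurableX mB mA)).

(* The canonical measure structure on the pushforward takes the measurability
   of the map as an explicit argument. *)
Let diagkept : {measure set (T * T)%type -> \bar R} :=
  measure_function_pushforward__canonical__measure_function_Measure kept mdiag.

(** Read from the second to the first marginal, this plan moves a fraction [s]
of the mass of [A] onto [B] and leaves the rest in place. *)
Definition transport_plan : set (T * T) -> \bar R :=
  measure_add diagkept moved.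

HB.instance Definition _ := Measure.on transport_plan.

Lemma ge0_integral_transport_plan f :
  measurable_fun setT f -> (forall z, 0 <= f z) ->
  \int[transport_plan]_z f z =
    \int[P]_(x in ~` A) f (x, x) + (1 - s)%:E * \int[P]_(x in A) f (x, x) +
    c%:E * \int[P \x P]_(z in B `*` A) f z.
Proof.
move=> mf f0.
have mfd : measurable_fun setT (f \o diag) by exact: measurableT_comp.
rewrite ge0_integral_measure_add// ge0_integral_mscale// ge0_integral_mrestr//.
congr (_ + _); rewrite ge0_integral_pushforward//= preimage_setT.
rewrite ge0_integral_measure_add// ge0_integral_mscale//.
by rewrite !ge0_integral_mrestr.
Qed.

(** The normalisation [c P(B) = s] makes the moved mass replace exactly what was
removed from [A]. *)
Lemma transport_plan_snd f : measurable_fun setT f -> (forall x, 0 <= f x) ->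
  \int[transport_plan]_z f z.2 = \int[P]_x f x.
Proof.
move=> mf f0; rewrite ge0_integral_transport_plan//; last first.
  exact: measurableT_comp.
rewrite fubini_tonelli2_setX//; last exact: measurableT_comp.
rewrite [X in _ + _ * X](eq_integral (fun y => f y * P B)); last first.
  by move=> y _; exact: (integral_cst P mB (f y)).
rewrite ge0_integralZr//; last exact: measurable_funTS.
rewrite [X in _ + _ + X]muleCA cB [X in _ + _ + X]muleC -addeA -ge0_muleDl ?lee_fin//.
by rewrite -EFinD subrK mul1e [RHS](ge0_integral_setC _ mA)// addeC.
Qed.

(** The first marginal [mu] satisfies [mu + s P|A = P + c P(A) P|B]. Keeping the
removed mass on the left avoids subtracting possibly infinite integrals. *)
Lemma transport_plan_fst f : measurable_fun setT f -> (forall x, 0 <= f x) ->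
  \int[transport_plan]_z f z.1 + s%:E * \int[P]_(x in A) f x =
  \int[P]_x f x + c%:E * P A * \int[P]_(x in B) f x.
Proof.
move=> mf f0; rewrite ge0_integral_transport_plan//; last first.
  exact: measurableT_comp.
rewrite fubini_tonelli1_setX//; last exact: measurableT_comp.
rewrite [X in _ + _ * X + _](eq_integral (fun x => f x * P A)); last first.
  by move=> x _; exact: (integral_cst P mA (f x)).
rewrite ge0_integralZr//; last exact: measurable_funTS.
rewrite addeAC -[X in X + _]addeA -ge0_muleDl ?lee_fin// -EFinD subrK mul1e.
rewrite [X in _ = X + _](ge0_integral_setC _ mA)// [X in X + _ = _]addeC.
by rewrite -muleA [X in _ + _ * X = _]muleC.
Qed.

Lemma transport_plan_setT : transport_plan setT = 1.
Proof.
have := @transport_plan_snd (cst 1) (measurable_cst _) (fun=> lee01).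
rewrite !integral_cst// !mul1e => ->; exact: probability_setT.
Qed.

(** The three integral formulas are all that is used about the plan: its
marginals, and the cost of a transport that is free on the diagonal. *)
Lemma transport_plan_exists : exists gamma : probability (T * T)%type R,
  [/\ forall f, measurable_fun setT f -> (forall x, 0 <= f x) ->
        \int[gamma]_z f z.2 = \int[P]_x f x,
      forall f, measurable_fun setT f -> (forall x, 0 <= f x) ->
        \int[gamma]_z f z.1 + s%:E * \int[P]_(x in A) f x =
        \int[P]_x f x + c%:E * P A * \int[P]_(x in B) f x &
      forall f, measurable_fun setT f -> (forall z, 0 <= f z) ->
        (forall x, f (x, x) = 0) ->
        \int[gamma]_z f z = c%:E * \int[P \x P]_(z in B `*` A) f z].
Proof.
pose isP := Measure_isProbability.Build _ _ _ transport_plan transport_plan_setT.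
pose gamma : probability (T * T)%type R :=
  HB.pack_for (probability (T * T)%type R) transport_plan isP.
exists gamma; split=> f mf f0; [exact: transport_plan_snd|
  exact: transport_plan_fst|move=> fxx; rewrite ge0_integral_transport_plan//].
rewrite [X in X + _ + _]integral0_eq// [X in _ + _ * X + _]integral0_eq//.
by rewrite mule0 !add0e.
Qed.

End transport.

(** * Energy of the perturbed measure *)

Section affine_integral.
Context d (T : measurableType d) (R : realType) (m : {measure set T -> \bar R}).

Lemma eq_ge0_integral_affine (f1 f2 f3 f4 : T -> \bar R) (s k : R) :
  measurable_fun setT f1 -> measurable_fun setT f2 ->
  measurable_fun setT f3 -> measurable_fun setT f4 ->
  (forall x, 0 <= f1 x) -> (forall x, 0 <= f2 x) ->
  (forall x, 0 <= f3 x) -> (forall x, 0 <= f4 x) ->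
  (0 <= s)%R -> (0 <= k)%R ->
  (forall x, f1 x + s%:E * f2 x = f3 x + k%:E * f4 x) ->
  \int[m]_x f1 x + s%:E * \int[m]_x f2 x =
  \int[m]_x f3 x + k%:E * \int[m]_x f4 x.
Proof.
move=> m1 m2 m3 m4 p1 p2 p3 p4 s0 k0 f1234.
rewrite -!ge0_integralZl_EFin// -!ge0_integralD//.
- by apply: eq_integral => x _; exact: f1234.
- by move=> x _; rewrite mule_ge0 ?lee_fin.
- exact: emeasurable_funM.
- by move=> x _; rewrite mule_ge0 ?lee_fin.
- exact: emeasurable_funM.
Qed.

End affine_integral.

(** The real arithmetic behind the expansion of the energy: [r] is the energy of
the perturbed measure, [u] its interaction with [A], and [jXY] the interaction
of [X] with [Y]. *)
Lemma quadratic_expansion (R : comRingType) (s k r u : R)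
    (jTT jTA jAT jTB jBT jAA jAB jBA jBB : R) :
  (u = jTA + k * jBA - s * jAA)%R ->
  (r + s * u = jTT + k * jBT - s * jAT + k * (jTB + k * jBB - s * jAB))%R ->
  jTA = jAT -> jTB = jBT ->
  (r = jTT + 2 * (k * jBT - s * jAT) +
    (k ^+ 2 * jBB - k * s * (jAB + jBA) + s ^+ 2 * jAA))%R.
Proof.
move=> -> H eA eB.
by rewrite -[r in LHS](addrK (s * (jTA + k * jBA - s * jAA))%R) H eA eB; ring.
Qed.

Section energy_of_perturbation.
Context d (T : measurableType d) (R : realType) (P : probability T R).
Variable g : T * T -> \bar R.
Hypotheses (mg : measurable_fun setT g) (g0 : forall z, 0 <= g z).
Hypothesis gC : forall x y, g (x, y) = g (y, x).
Hypothesis gfin : \int[P \x P]_z g z < +oo.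

Definition potential D x := \int[P]_(y in D) g (x, y).

Definition interaction C D := \int[P]_(x in C) potential D x.

Lemma potential_ge0 D x : 0 <= potential D x.
Proof. exact: integral_ge0. Qed.

Lemma measurable_potential D : measurable D ->
  measurable_fun setT (potential D).
Proof.
move=> mD; pose h := g \_ (setT `*` D).
rewrite (_ : potential D = fubini_F P h).
  apply: measurable_fun_fubini_tonelli_F => [|z]; last exact: erestrict_ge0.
  apply/measurable_restrict => //; first exact: measurableX.
  exact: measurable_funTS.
apply/funext => x; rewrite /potential integral_mkcond.
by apply: eq_integral => y _; rewrite /h !patchE in_setX in_setT.
Qed.

Lemma interactionTT : interaction setT setT = \int[P \x P]_z g z.
Proof. by rewrite fubini_tonelli1. Qed.

(** Tonelli's theorem and the symmetry of the kernel. *)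
Lemma interactionC C D : measurable C -> measurable D ->
  interaction C D = interaction D C.
Proof.
move=> mC mD; rewrite /interaction /potential -fubini_tonelli1_setX//.
transitivity (\int[P]_(y in D) \int[P]_(x in C) g (x, y)).
  exact: fubini_tonelli2_setX.
by apply: eq_integral => y _; apply: eq_integral => x _; exact: gC.
Qed.

Lemma interaction_fin C D : measurable C -> measurable D ->
  interaction C D \is a fin_num.
Proof.
move=> mC mD; rewrite ge0_fin_numE; last first.
  by apply: integral_ge0 => x _; exact: potential_ge0.
rewrite /interaction /potential -fubini_tonelli1_setX//; apply: le_lt_trans gfin.
apply: ge0_subset_integral => //; exact: measurableX.
Qed.

(** From here on [mu] is a perturbation of [P] with [mu + s P|A = P + k P|B]. *)
Variables (A B : set T) (mA : measurable A) (mB : measurable B) (s k : R).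
Hypotheses (s0 : (0 <= s)%R) (k0 : (0 <= k)%R).
Variable mu : probability T R.
Hypothesis muE : forall f, measurable_fun setT f -> (forall x, 0 <= f x) ->
  \int[mu]_x f x + s%:E * \int[P]_(x in A) f x =
  \int[P]_x f x + k%:E * \int[P]_(x in B) f x.

Let J C D := fine (interaction C D).

Let fin_left (x y z : \bar R) : 0 <= x -> 0 <= y -> x + y = z ->
  z \is a fin_num -> x \is a fin_num.
Proof.
move=> x0 y0 <-; rewrite !ge0_fin_numE ?adde_ge0//.
by apply: le_lt_trans; rewrite leeDl.
Qed.

(** The defining identity of [mu], tested against the potential of [D]. *)
Lemma integral_perturbation_potential D : measurable D ->
  \int[mu]_x potential D x = (J setT D + k * J B D - s * J A D)%:E.
Proof.
move=> mD.
have : \int[mu]_x potential D x + s%:E * interaction A D =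
    interaction setT D + k%:E * interaction B D.
  exact: muE (measurable_potential mD) (potential_ge0 D).
rewrite -[interaction A D]fineK ?interaction_fin//.
rewrite -[interaction B D]fineK ?interaction_fin//.
rewrite -[interaction setT D]fineK ?interaction_fin//.
rewrite -/(J A D) -/(J B D) -/(J setT D) -!EFinM -[RHS]EFinD => H.
have J0 : (0 <= J A D)%R.
  by apply: fine_ge0; apply: integral_ge0 => x _; exact: potential_ge0.
have : \int[mu]_x potential D x \is a fin_num.
  apply: fin_left H _ => //; last by rewrite lee_fin mulr_ge0.
  by apply: integral_ge0 => x _; exact: potential_ge0.
move: H; case: (integral _ _ _) => // r; rewrite -EFinD => -[H] _.
by congr (_%:E); lra.
Qed.

(** The identity of [mu] is used twice, once in each variable of the kernel. The
first order term compares the potential of [P] on [B] with that on [A]. *)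
Lemma energy_perturbation :
  \int[mu \x mu]_z g z =
  (J setT setT + 2 * (k * J B setT - s * J A setT) +
   (k ^+ 2 * J B B - k * s * (J A B + J B A) + s ^+ 2 * J A A))%:E.
Proof.
rewrite fubini_tonelli1//.
pose M x := \int[mu]_y g (x, y).
have mM : measurable_fun setT M by exact: measurable_fun_fubini_tonelli_F.
have M0 x : 0 <= M x by exact: integral_ge0.
(* The identity of mu in the second variable. *)
have ME x : M x + s%:E * potential A x = potential setT x + k%:E * potential B x.
  by apply: muE => //; exact: measurableT_comp.
have mp D : measurable D -> measurable_fun setT (potential D).
  exact: measurable_potential.
have := eq_ge0_integral_affine mu mM (mp A mA) (mp setT measurableT) (mp B mB)
  M0 (potential_ge0 A) (potential_ge0 setT) (potential_ge0 B) s0 k0 ME.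
have [uA uAE EA] : exists2 u, u = (J setT A + k * J B A - s * J A A)%R &
    \int[mu]_x potential A x = u%:E.
  by eexists; last exact: integral_perturbation_potential.
rewrite EA !integral_perturbation_potential// => H.
have uA0 : 0 <= uA%:E.
  by rewrite -EA; apply: integral_ge0 => x _; exact: potential_ge0.
have /EFin_fin_numP[r Mr] : \int[mu]_x M x \is a fin_num.
  apply: fin_left H _; first exact: integral_ge0.
  - by rewrite mule_ge0// lee_fin.
  - by rewrite -EFinM -EFinD.
have JC C D : measurable C -> measurable D -> J C D = J D C.
  by move=> mC mD; rewrite /J interactionC.
transitivity (r%:E); first exact: Mr.
move: H; rewrite Mr -EFinM -EFinD -EFinM -[RHS]EFinD => -[H]; congr (_%:E).
exact: quadratic_expansion uAE H (JC _ _ measurableT mA) (JC _ _ measurableT mB).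
Qed.

End energy_of_perturbation.

(** * Lowering the energy *)

(** If the potential is at most [low] on [B] and at least [high] on [A], the
first order term is at most [- 2 s a (high - low)], where [a] is the mass of
[A]; it beats the second order term as soon as [s] is small. *)
Lemma first_order_decrease (R : realType) (s a k low high : R)
    (jTT jA jB jAA jAB jBA jBB : R) :
  (0 <= s -> high * a <= jA -> k * jB <= low * a ->
  s ^+ 2 * (k ^+ 2 * jBB - k * (jAB + jBA) + jAA) < 2 * (s * (a * (high - low))) ->
  jTT + 2 * (s * k * jB - s * jA) +
    ((s * k) ^+ 2 * jBB - s * k * s * (jAB + jBA) + s ^+ 2 * jAA) < jTT)%R.
Proof.
move=> s0 /(ler_wpM2l s0) hA /(ler_wpM2l s0) hB.
rewrite -subr_gt0 => hq; rewrite -subr_gt0; nra.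
Qed.

Section lowering_energy.
Context d (T : measurableType d) (R : realType) (P : probability T R).
Variable g : T * T -> \bar R.
Hypotheses (mg : measurable_fun setT g) (g0 : forall z, 0 <= g z).
Hypothesis gC : forall x y, g (x, y) = g (y, x).
Hypothesis gfin : \int[P \x P]_z g z < +oo.

(** One fraction [s] is small enough both for the transport cost, at most [s C],
and for the first order term of the energy to prevail. *)
Lemma transfer_size (a D q C delta : R) :
  (0 < a -> 0 < D -> 0 <= C -> 0 < delta ->
   exists s, [/\ 0 < s, s <= 1, s * C < delta & 2 * (s * (a * D)) > s ^+ 2 * q])%R.
Proof.
move=> a0 D0 C0 delta0; have aD : (0 < a * D)%R by rewrite mulr_gt0.
have q1 : (0 < `|q| + 1)%R by rewrite ltr_wpDl.
have C1 : (0 < C + 1)%R by rewrite ltr_wpDl.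
exists (Num.min 1 (Num.min (a * D / (`|q| + 1)) (delta / (C + 1))))%R.
set s := Num.min _ _.
have s0 : (0 < s)%R by rewrite !lt_min ltr01 !divr_gt0.
have s1 : (s <= 1)%R by rewrite ge_min lexx.
have : (s <= a * D / (`|q| + 1))%R by rewrite !ge_min lexx !orbT.
rewrite ler_pdivlMr// => sq.
have : (s <= delta / (C + 1))%R by rewrite !ge_min lexx !orbT.
rewrite ler_pdivlMr// => sC.
split=> //; first by lra.
have := ler_norm q; nra.
Qed.

(** Moving a little mass from where the potential is high to where it is low
lowers the energy, at a transport cost as small as desired. Only the bound of
the cost on [B `*` A] matters, so [P] itself may have infinite moments. *)
Lemma lower_energy (A B : set T) (mA : measurable A) (mB : measurable B)
    (low high C delta : R) (h : T * T -> \bar R) :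
  0 < P A -> 0 < P B -> (low < high)%R ->
  high%:E * P A <= \int[P]_(x in A) potential P g setT x ->
  \int[P]_(x in B) potential P g setT x <= low%:E * P B ->
  measurable_fun setT h -> (forall z, 0 <= h z) -> (forall x, h (x, x) = 0) ->
  (forall z, (B `*` A) z -> h z <= C%:E) -> (0 <= C)%R -> (0 < delta)%R ->
  exists (gamma : probability (T * T)%type R) (mu : probability T R),
    [/\ forall X, measurable X ->
         gamma (fst @^-1` X) = mu X /\ gamma (snd @^-1` X) = P X,
       \int[gamma]_z h z < delta%:E &
       \int[mu \x mu]_z g z < \int[P \x P]_z g z].
Proof.
move=> PA0 PB0 lowhigh highA lowB mh h0 hxx hC C0 delta0.
have Pfin X : measurable X -> P X \is a fin_num by move=> mX; exact: fin_num_measure.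
pose a := fine (P A); pose b := fine (P B).
have aE : P A = a%:E by rewrite fineK// Pfin.
have bE : P B = b%:E by rewrite fineK// Pfin.
have a0 : (0 < a)%R by rewrite -lte_fin -aE.
have b0 : (0 < b)%R by rewrite -lte_fin -bE.
have a1 : (a <= 1)%R by rewrite -lee_fin -aE probability_le1.
pose J X Y := fine (interaction P g X Y).
have JfinE X Y : measurable X -> measurable Y -> interaction P g X Y = (J X Y)%:E.
  by move=> mX mY; rewrite fineK// interaction_fin.
have JA : (high * a <= J A setT)%R.
  by rewrite -lee_fin -JfinE// EFinM -aE.
have JB : (J B setT <= low * b)%R.
  by rewrite -lee_fin -JfinE// EFinM -bE.
(* The mass s a taken from A has density s a / b with respect to P on B. *)
have [s [s0 s1 sC sq]] := @transfer_size a (high - low)%R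
  ((a / b) ^+ 2 * J B B - (a / b) * (J A B + J B A) + J A A)%R C delta
  a0 (etrans (subr_gt0 _ _) lowhigh) C0 delta0.
have c0 : (0 <= s / b)%R by rewrite divr_ge0// ltW.
have cB : (s / b)%:E * P B = s%:E by rewrite bE -EFinM divfK// gt_eqF.
have [gamma [gsnd gfst gint]] := transport_plan_exists mA mB (ltW s0) s1 c0 cB.
pose Fst : {mfun (T * T)%type >-> T} :=
  HB.pack (@fst T T) (isMeasurableFun.Build _ _ _ _ _ measurable_fst).
pose mu : probability T R := distribution gamma Fst.
have muE f : measurable_fun setT f -> (forall x, 0 <= f x) ->
    \int[mu]_x f x = \int[gamma]_z f z.1.
  by move=> mf f0; rewrite ge0_integral_distribution.
exists gamma, mu; split.
- move=> X mX; split=> //.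
  have m1 : measurable_fun setT (EFin \o \1_X : T -> \bar R).
    by apply/measurable_EFinP; exact: measurable_indic.
  have indic_ge0 x : 0 <= (EFin \o \1_X : T -> \bar R) x by rewrite lee_fin.
  have mX2 : measurable (snd @^-1` X : set (T * T)).
    by rewrite -[X in measurable X]setTI; exact: measurable_snd.
  have := gsnd _ m1 indic_ge0.
  have <- : \int[P]_x (\1_X x)%:E = P X by rewrite integral_indic// setIT.
  by move=> <-; rewrite -[LHS]/(gamma _) -[X in gamma X]setIT -integral_indic.
- rewrite gint//; apply: (@le_lt_trans _ _ (s * C)%:E); last by rewrite lte_fin.
  apply: (@le_trans _ _ ((s / b)%:E * (C%:E * (P \x P) (B `*` A)))).
    rewrite lee_pmul2l ?lte_fin ?divr_gt0//.
    rewrite -integral_cst; last exact: measurableX.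
    apply: ge0_le_integral => //; first exact: measurableX.
    exact: measurable_funTS.
  have -> : (P \x P) (B `*` A) = b%:E * a%:E.
    by rewrite -aE -bE; exact: product_measure1E.
  rewrite -!EFinM lee_fin.
  rewrite [leLHS](_ : _ = (s * C) * a)%R; last by field; rewrite gt_eqF.
  by rewrite ler_piMr// mulr_ge0// ltW.
- have ab0 : (0 <= s * (a / b))%R by rewrite mulr_ge0 ?divr_ge0// ltW.
  have H f : measurable_fun setT f -> (forall x, 0 <= f x) ->
      \int[mu]_x f x + s%:E * \int[P]_(x in A) f x =
      \int[P]_x f x + (s * (a / b))%:E * \int[P]_(x in B) f x.
    move=> mf f0; rewrite muE// gfst// aE -EFinM; congr (_ + _%:E * _).
    by rewrite mulrAC mulrA.
  rewrite (energy_perturbation mg g0 gC gfin mA mB (ltW s0) ab0 H).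
  have -> : \int[P \x P]_z g z = (J setT setT)%:E.
    by rewrite -(JfinE setT setT)//; apply/esym; exact: interactionTT.
  rewrite lte_fin; apply: first_order_decrease JA _ sq; first exact: ltW.
  apply: le_trans (ler_wpM2l _ JB) _; first by rewrite divr_ge0// ltW.
  by rewrite mulrCA divfK// gt_eqF.
Qed.

End lowering_energy.

(** * Integrals of functions bounded from below *)

Section probability_facts.
Context d (T : measurableType d) (R : realType) (P : probability T R).

Lemma exhaust_lt (F : (set T)^nat) (X : set T) (c : \bar R) :
  measurable X -> (forall n, measurable (F n)) ->
  nondecreasing_seq F -> \bigcup_n F n = setT ->
  c < P X -> exists n, c < P (X `&` F n).
Proof.
move=> mX mF ndF FT cX.
have mXF n : measurable (X `&` F n) by exact: measurableI.
have PF : P (X `&` F n) @[n --> \oo] --> P X.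
  rewrite -[X in _ --> P X]setIT -FT setI_bigcupr.
  apply: nondecreasing_cvg_mu => //; first exact: bigcup_measurable.
  by move=> m n mn; apply/subsetPset; apply: setIS; exact/subsetPset/ndF.
by have [n _ /(_ n (leqnn n))] := PF _ (open_ereal_gt' cX); exists n.
Qed.

(** A function that exceeds [k] almost everywhere has integral at least [k]. *)
Lemma measure_sublevel_gt0 (f : T -> \bar R) (k : R) :
  measurable_fun setT f -> (forall x, 0 <= f x) ->
  (0 <= k)%R -> \int[P]_x f x < k%:E -> 0 < P [set x | f x <= k%:E].
Proof.
move=> mf f0 k0 fk; rewrite lt0e measure_ge0 andbT; apply/eqP => S0.
have mS : measurable [set x | f x <= k%:E].
  by rewrite -[X in measurable X]setTI; exact: emeasurable_fun_infty_c.
move: fk; apply/negP; rewrite -leNgt.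
rewrite (ge0_negligible_integral mS)// setTD.
apply: (@le_trans _ _ (\int[P]_(x in ~` [set x | f x <= k%:E]) (cst k%:E) x)).
  rewrite integral_cst; last exact: measurableC.
  rewrite [X in _ * X](_ : _ = 1) ?mule1//.
  by rewrite -[RHS]sube0 -S0; exact: probability_setC.
apply: ge0_le_integral => //; first exact: measurableC.
  exact: measurable_funTS.
by move=> x /= /negP; rewrite -ltNge => /ltW.
Qed.

(** Subtracting the lower bound reduces functions bounded from below to
nonnegative ones, for which no integrability is needed. *)
Lemma integral_subl (f : T -> \bar R) (c : R) :
  measurable_fun setT f -> (forall x, c%:E <= f x) ->
  \int[P]_x (f x - c%:E) < +oo ->
  \int[P]_x f x = \int[P]_x (f x - c%:E) + c%:E.
Proof.
move=> mf cf fin.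
have f0 x : 0 <= f x - c%:E by rewrite sube_ge0.
have mfc : measurable_fun setT (fun x => f x - c%:E) by exact: emeasurable_funB.
have cE : \int[P]_x cst c%:E x = c%:E.
  rewrite integral_cst// [X in _ * X](_ : _ = 1) ?mule1//.
  exact: probability_setT.
rewrite -[X in _ = _ + X]cE -integralD//; last 2 first.
- apply/integrableP; split; first exact: mfc.
  rewrite (eq_integral (fun x => f x - c%:E))// => x _.
  by rewrite gee0_abs.
- exact: finite_measure_integrable_cst.
by apply: eq_integral => x _; apply/esym; exact: subeK.
Qed.

(** The negative part is bounded, so a finite upper bound on the integral bounds
the integral of the positive part. *)
Lemma integral_subl_lty (f : T -> \bar R) (c : R) :
  measurable_fun setT f -> (forall x, c%:E <= f x) ->
  \int[P]_x f x < +oo -> \int[P]_x (f x - c%:E) < +oo.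
Proof.
move=> mf cf; rewrite integralE => finf.
have mneg : measurable_fun setT f^\- by exact: measurable_funeneg.
have mpos : measurable_fun setT f^\+ by exact: measurable_funepos.
have int_cst (a : R) : \int[P]_x cst a%:E x = a%:E.
  rewrite integral_cst// [X in _ * X](_ : _ = 1) ?mule1//.
  exact: probability_setT.
have neg_fin : \int[P]_x f^\- x \is a fin_num.
  rewrite ge0_fin_numE ?integral_ge0//.
  apply: (@le_lt_trans _ _ (`|c|)%:E); last exact: ltry.
  rewrite -int_cst; apply: ge0_le_integral => // x _ /=.
  rewrite funenegE ge_max lee_fin normr_ge0 andbT leeNl -EFinN.
  by apply: le_trans (cf x); rewrite lee_fin lerNl -normrN ler_norm.
have pos_fin : \int[P]_x f^\+ x < +oo.
  by move: finf; rewrite !ltey; apply: contra => /eqP ->; rewrite -(fineK neg_fin).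
apply: (@le_lt_trans _ _ (\int[P]_x (f^\+ x + cst (`|c|)%:E x))).
  apply: ge0_le_integral => //.
  - by move=> x _; rewrite sube_ge0.
  - exact: emeasurable_funB.
  - exact: emeasurable_funD.
  - move=> x _; apply: leeD; first by rewrite funeposE le_max lexx.
    by rewrite -EFinN lee_fin -normrN ler_norm.
rewrite ge0_integralD//; last by move=> x _; rewrite lee_fin.
apply: lte_add_pinfty => //.
by have -> := int_cst `|c|%R; exact: ltry.
Qed.

End probability_facts.

(** * Bounded supports and potentials at infinity *)

Section sqnorm_balls.
Context {R : realType} {d : nat}.

Definition sqball (M : R) : set 'rV[R]_d := [set x | (sqnorm x <= M)%R].

Lemma measurable_sqball M : measurable (sqball M).
Proof.
rewrite -[X in measurable X]setTI (_ : sqball M = sqnorm @^-1` `]-oo, M]%classic).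
  by apply: measurable_sqnorm => //; exact: measurable_itv.
by apply/seteqP; split=> x; rewrite /= in_itv.
Qed.

Lemma exhaust_sqball (P : probability 'rV[R]_d R) (X : set 'rV[R]_d) (c : \bar R) :
  measurable X -> c < P X -> exists n, c < P (X `&` sqball n%:R).
Proof.
move=> mX; apply: (@exhaust_lt _ _ _ _ (fun n => sqball n%:R)) => //.
- by move=> n; exact: measurable_sqball.
- by move=> m n mn; apply/subsetPset => x; move/le_trans; apply; rewrite ler_nat.
- apply/seteqP; split=> // x _; exists (Num.truncn (sqnorm x)).+1 => //.
  by rewrite /sqball/= ltW// truncnS_gt.
Qed.

Lemma msupport_closed (P : probability 'rV[R]_d R) : closed (msupport P).
Proof.
rewrite -[msupport P]setCK; apply: open_closedC; rewrite openE => x /=.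
move/existsNP => [U /not_implyP[oU /not_implyP[Ux /negP PU]]].
have : nbhs x U by exact: open_nbhs_nbhs.
by apply: filterS => y Uy; apply/existsNP; exists U; move=> /(_ oU Uy); exact/negP.
Qed.

(** A point of the support with a coordinate of square larger than [r] would
have an open neighbourhood, cut out by that coordinate, disjoint from the ball
that carries [P]. *)
Lemma msupport_compact (P : probability 'rV[R]_d R) (r : R) :
  P (~` sqball r) = 0 -> compact (msupport P).
Proof.
move=> Pr; apply: (@sqnorm_bounded_compact _ _ _ r) => [|x i Px].
  exact: msupport_closed.
rewrite leNgt; apply/negP => xr.
pose V : set 'rV[R]_d := [set y | (r < y ord0 i ^+ 2)%R].
have oV : open V.
  have cf : continuous (fun y : 'rV[R]_d => (y ord0 i ^+ 2)%R).
    move=> y; apply: (@continuous_comp _ _ _ (fun y : 'rV[R]_d => y ord0 i)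
      (fun t : R => t ^+ 2)%R); first exact: coord_continuous.
    exact: exprn_continuous.
  rewrite (_ : V = (fun y : 'rV[R]_d => (y ord0 i ^+ 2)%R) @^-1` [set t | (r < t)%R])//.
  apply: open_comp; [by move=> y _; exact: cf|exact: open_gt].
have := Px V oV xr; rewrite ltNge => /negP; apply.
rewrite -Pr; apply: le_measure; rewrite ?inE.
- exact: sub_sigma_algebra.
- by apply: measurableC; exact: measurable_sqball.
- move=> y /= Vy; apply/negP; rewrite -ltNge; apply: lt_le_trans Vy _.
  rewrite /sqnorm (bigD1 i)//= lerDl; apply: sumr_ge0 => j _; exact: sqr_ge0.
Qed.

(** Most of the mass sits in a fixed ball, and the distance from a far point to
that ball is large; so the potential at a far point nearly reaches the values
of [w] at infinity. *)
Lemma potential_far (P : probability 'rV[R]_d R) (w : 'rV[R]_d -> \bar R)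
    (c r eta M : R) (x : 'rV[R]_d) :
  measurable_fun setT w -> (forall z, 0 <= w z) -> (0 <= c)%R ->
  (forall z, (r < sqnorm z)%R -> c%:E <= w z) ->
  eta%:E <= P (sqball M) -> (2 * r + 2 * M < sqnorm x)%R ->
  (c * eta)%:E <= potential P (fun z => w (z.1 - z.2)%R) setT x.
Proof.
move=> mw w0 c0 wc Peta xr.
have mwx : measurable_fun setT (fun y : 'rV[R]_d => w (x - y)%R).
  have mg := measurableT_comp mw (@measurable_subr R d).
  exact: (measurableT_comp mg (pair1_measurable x)).
apply: (@le_trans _ _ (\int[P]_(y in sqball M) w (x - y)%R)); last first.
  by apply: ge0_subset_integral => //; exact: measurable_sqball.
apply: (@le_trans _ _ (\int[P]_(y in sqball M) cst c%:E y)).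
  rewrite integral_cst; last exact: measurable_sqball.
  by rewrite EFinM lee_wpmul2l// lee_fin.
apply: ge0_le_integral => //; first exact: measurable_sqball.
  exact: measurable_funTS.
move=> y /= yM; apply: wc.
have := sqnorm_leB x y; rewrite /sqball/= in yM; move: xr yM.
set a := sqnorm x; set b := sqnorm (x - y); set e := sqnorm y; lra.
Qed.

End sqnorm_balls.

(** * Local minimisers *)

Section energy_shift.
Context {R : realType} {d : nat}.
Variables (W : 'rV[R]_d -> \bar R) (Wmin : R).
Hypotheses (mW : measurable_fun setT W) (W_ge : forall x, Wmin%:E <= W x).

Let w x := W x - Wmin%:E.
Let g (z : 'rV[R]_d * 'rV[R]_d) := w (z.1 - z.2)%R.

Let mWB : measurable_fun setT (fun z : 'rV[R]_d * 'rV[R]_d => W (z.1 - z.2)%R).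
Proof. exact: (measurableT_comp mW measurable_subr). Qed.

Lemma energy_shift (P : probability 'rV[R]_d R) :
  \int[P \x P]_z g z < +oo ->
  energy W P = (2^-1)%:E * (\int[P \x P]_z g z + Wmin%:E).
Proof.
move=> gfin; rewrite /energy; congr (_ * _).
exact: (integral_subl mWB (fun z => W_ge _) gfin).
Qed.

Lemma energy_lty (P : probability 'rV[R]_d R) :
  energy W P < +oo -> \int[P \x P]_z g z < +oo.
Proof.
move=> EP; apply: (integral_subl_lty mWB (fun z => W_ge _)).
move: EP; rewrite /energy !ltey; apply: contra => /eqP.
move=> H; rewrite [X in _ * X]H gt0_muley// lte_fin invr_gt0 ltr0n//.
Qed.

End energy_shift.

Section wasserstein.
Context {R : realType} {d : nat}.

Lemma wasserstein2_lt (mu nu : probability 'rV[R]_d R)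
    (gamma : probability ('rV[R]_d * 'rV[R]_d)%type R) (e : R) :
  coupling mu nu gamma -> (0 < e)%R ->
  \int[gamma]_z (enorm (z.1 - z.2) ^+ 2)%:E < (e ^+ 2)%:E ->
  wasserstein2 mu nu < e%:E.
Proof.
move=> cgamma e0 ge; rewrite /wasserstein2; set I := ereal_inf _.
have Ige : I < (e ^+ 2)%:E.
  by apply: le_lt_trans ge; apply: ereal_inf_lbound; exists gamma.
have I0 : 0 <= I.
  apply: le_ereal_inf_tmp => _ [g _ <-]; apply: integral_ge0 => z _.
  by rewrite lee_fin sqr_ge0.
rewrite poweR12_sqrt//.
move: Ige I0; case: I => // r; rewrite lte_fin lee_fin => re r0 /=.
by rewrite lte_fin -(ltr_pXn2r (n := 2))// ?nnegrE ?sqrtr_ge0 ?(ltW e0)// sqr_sqrtr.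
Qed.

End wasserstein.

Lemma real_between (R : realType) (a : R) (b : \bar R) :
  a%:E < b -> exists2 c : R, (a < c)%R & c%:E < b.
Proof.
case: b => [r||]//; rewrite ?lte_fin => ab.
- by exists ((a + r) / 2)%R; rewrite ?lte_fin ?midf_lt.
- by exists (a + 1)%R; rewrite ?ltrDl// ltry.
Qed.

Lemma infty_rV_sqnorm (R : realType) (d : nat) (S : set 'rV[R]_d) :
  infty_rV S -> exists r : R, forall z, (r < sqnorm z)%R -> S z.
Proof.
move=> [M _ MS]; exists (Num.max 0 M ^+ 2)%R => z zr; apply: MS => /=.
apply: (@le_lt_trans _ _ (Num.max 0 M)%R); first by rewrite le_max lexx orbT.
rewrite -(ltr_pXn2r (n := 2))// ?nnegrE ?sqrtr_ge0 ?le_max ?lexx//.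
by rewrite enorm_sqr.
Qed.

Theorem corollary2p11 (R : realType) (d : nat) (d_ge1 : (1 <= d)%N)
  (W : 'rV[R]_d -> \bar R) (W_neqNy : forall x, W x != -oo)
  (W_meas : measurable_fun setT W)
  (Wmin : R) (Wmin_lt0 : (Wmin < 0)%R) (W_ge : forall x, Wmin%:E <= W x)
  (W_loc : forall (c : 'rV[R]_d) (r : R), (0 < r)%R ->
    \int[lebesgue_rV]_(x in eball c r) `|W x| < +oo)
  (W_sym : forall x, W x = W (- x)%R)
  (W_lsc : lower_semicontinuous W)
  (Winf : \bar R) (W_lim : W x @[x --> infty_rV] --> Winf)
  (rho : probability 'rV[R]_d R)
  (rho_min : d2_local_minimiser W rho)
  (rho_lt : energy W rho < (2^-1)%:E * Winf) :
  compactly_supported rho.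
Proof.
pose w x := W x - Wmin%:E.
pose g (z : 'rV[R]_d * 'rV[R]_d) := w (z.1 - z.2)%R.
have w0 x : 0 <= w x by rewrite sube_ge0.
have mw : measurable_fun setT w by exact: emeasurable_funB.
have mg : measurable_fun setT g by exact: (measurableT_comp mw measurable_subr).
have g0 z : 0 <= g z by exact: w0.
have gC x y : g (x, y) = g (y, x).
  by rewrite /g /w/= W_sym opprB.
have h0 : (0 < 2^-1 :> R)%R by rewrite invr_gt0 ltr0n.
have gfin : \int[rho \x rho]_z g z < +oo.
  by apply: (energy_lty W_meas W_ge); apply: lt_le_trans rho_lt (leey _).
have [i iE] : exists i, \int[rho \x rho]_z g z = i%:E.
  exists (fine (\int[rho \x rho]_z g z)); rewrite fineK// ge0_fin_numE//.
  exact: integral_ge0.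
have i0 : (0 <= i)%R by rewrite -lee_fin -iE; exact: integral_ge0.
have rhoE : energy W rho = (2^-1)%:E * (i + Wmin)%:E.
  by rewrite (energy_shift W_meas W_ge gfin) EFinD -iE.
have iWinf : (i + Wmin)%:E < Winf.
  by move: rho_lt; rewrite rhoE lte_pmul2l.
have [c' ic' c'Winf] := real_between iWinf.
pose c := (c' - Wmin)%R.
have ic : (i < c)%R by rewrite /c ltrBrDr.
have [r rc] : exists r : R, forall z, (r < sqnorm z)%R -> c%:E <= w z.
  have [r rP] := infty_rV_sqnorm (W_lim _ (open_ereal_gt' c'Winf)).
  exists r => z /rP /= c'W; rewrite /w EFinB leeB//; exact: ltW.
have c0 : (0 < c)%R by exact: le_lt_trans ic.
(* The mass eta < 1 is chosen so that c * eta is the midpoint of i and c, hence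
   still larger than the average i of the potential. *)
pose eta := ((i + c) / 2 / c)%R.
have eta1 : (eta < 1)%R by rewrite /eta ltr_pdivrMr// mul1r; lra.
have [n neta] : exists n, eta%:E < rho (setT `&` sqball n%:R).
  apply: exhaust_sqball => //.
  have -> : rho setT = 1 by exact: probability_setT.
  by rewrite lte_fin.
rewrite setTI in neta.
pose high := (c * eta)%R.
have highE : high = ((i + c) / 2)%R by rewrite /high mulrC divfK// gt_eqF.
(* Any level strictly between the average i and the value high at far points. *)
pose low := ((i + high) / 2)%R.
pose r0 := (2 * r + 2 * n%:R)%R.
have far x : (r0 < sqnorm x)%R -> high%:E <= potential rho g setT x.
  by move=> xr; apply: (potential_far mw w0 (ltW c0) rc (ltW neta)).
apply: (@msupport_compact _ _ _ r0); apply/eqP.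
rewrite eq_le measure_ge0 andbT leNgt; apply/negP => X0.
have mpsi : measurable_fun setT (potential rho g setT).
  exact: measurable_potential.
have psi0 x : 0 <= potential rho g setT x by exact: potential_ge0.
have ilow : (i < low)%R by rewrite /low highE; lra.
have lowhigh : (low < high)%R by rewrite /low highE; lra.
(* The average of the potential is i < low, so its sublevel set is charged. *)
have B0 : 0 < rho [set x | potential rho g setT x <= low%:E].
  apply: measure_sublevel_gt0 => //; first by rewrite (le_trans i0)// ltW.
  rewrite [X in X < _](_ : _ = i%:E) ?lte_fin// -iE.
  exact: (interactionTT rho mg g0).
have mX : measurable (~` sqball r0 : set 'rV[R]_d).
  by apply: measurableC; exact: measurable_sqball.
have mS : measurable [set x | potential rho g setT x <= low%:E].
  by rewrite -[X in measurable X]setTI; exact: emeasurable_fun_infty_c.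
(* Bounded pieces are needed, so that mass travels a bounded distance. *)
have [n1 A0] := exhaust_sqball mX X0.
have [n2 B0'] := exhaust_sqball mS B0.
set A := _ `&` _ in A0; set B := _ `&` _ in B0'.
have mA : measurable A by apply: measurableI => //; exact: measurable_sqball.
have mB : measurable B by apply: measurableI => //; exact: measurable_sqball.
have [eps eps0 rhoeps] := rho_min.
pose h (z : 'rV[R]_d * 'rV[R]_d) := (enorm (z.1 - z.2) ^+ 2)%:E.
have hE z : h z = (sqnorm (z.1 - z.2))%:E by rewrite /h enorm_sqr.
have mh : measurable_fun setT h.
  rewrite (_ : h = EFin \o (@sqnorm R d \o (fun z => z.1 - z.2)%R)); last first.
    by apply/funext => z; rewrite hE.
  apply/measurable_EFinP.
  exact: (measurableT_comp measurable_sqnorm measurable_subr).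
have h_ge0 z : 0 <= h z by rewrite lee_fin sqr_ge0.
have hxx x : h (x, x) = 0.
  rewrite hE/= subrr /sqnorm big1// => j _; by rewrite mxE expr0n.
have hC z : (B `*` A) z -> h z <= (2 * n2%:R + 2 * n1%:R)%:E.
  move=> [[_ /= zB] [_ /= zA]]; rewrite hE lee_fin.
  apply: le_trans (sqnormB_le _ _) _.
  by apply: lerD; rewrite ler_wpM2l// ler0n.
have highA : high%:E * rho A <= \int[rho]_(x in A) potential rho g setT x.
  apply: (@le_trans _ _ (\int[rho]_(x in A) cst high%:E x)).
    by rewrite integral_cst.
  apply: ge0_le_integral => //.
  - by move=> x _; rewrite lee_fin (le_trans i0)// ltW// (lt_trans ilow).
  - exact: measurable_funTS.
  - by move=> x [/= /negP xr _]; apply: far; rewrite ltNge.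
have lowB : \int[rho]_(x in B) potential rho g setT x <= low%:E * rho B.
  apply: (@le_trans _ _ (\int[rho]_(x in B) cst low%:E x)); last first.
    by rewrite integral_cst.
  apply: ge0_le_integral => //; first exact: measurable_funTS.
  by move=> x [].
have C0 : (0 <= 2 * n2%:R + 2 * n1%:R :> R)%R by rewrite addr_ge0// mulr_ge0.
have [gamma [mu [gammaP costP muP]]] := lower_energy mg g0 gC gfin mA mB A0 B0'
  lowhigh highA lowB mh h_ge0 hxx hC C0 (exprn_gt0 2 eps0).
have := rhoeps mu (wasserstein2_lt gammaP eps0 costP).
rewrite (energy_shift W_meas W_ge (lt_trans muP gfin)).
rewrite (energy_shift W_meas W_ge gfin) lee_pmul2l ?lte_fin// leeD2rE//.
by rewrite leNgt muP.
Qed.
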